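(* Let $j\in\mathbb N$ and let $R_1,\dots,R_j$ be rings. For each $i$, let $\{N_{i1},\dots,N_{ik_i}\}$ be a collection of ideals of $R_i$ satisfying the CNC-condition, and let $s_{il}$ be the characteristic of $N_{il}$ in $N_{i(l+1)}$ for $1\le l\le k_i-1$. Suppose $(R_i/N_{i1})^*$ is finite for all $1\le i\le j$. Let $m_i=|(R_i/N_{i1})^*|\,s_{i1}s_{i2}\cdots s_{i(k_i-1)}$ and let $M$ be the least common multiple of $m_1,\dots,m_j$. Then $y^M=(1_{R_1},\dots,1_{R_j})$ for all $y=(y_1,\dots,y_j)\in R_1^*\times\cdots\times R_j^*$.
   Context: Rings are associative with identity, not necessarily commutative; $S^*$ denotes the group of units of a ring $S$. A collection $\{N_1,\dots,N_k\}$ of ideals of a ring $R$ satisfies the CNC-condition if: (i) $\{0\}=N_k\subset N_{k-1}\subset\cdots\subset N_1\subset R$; (ii) for each $i=1,\dots,k-1$ there is $t_i\ge 2$ with $N_i^{t_i}\subset N_{i+1}$ (the minimal such $t_i$ is the nilpotency index of $N_i$ in $N_{i+1}$); (iii) for each $i=1,\dots,k-1$ there is $s_i\ge 1$ with $s_iN_i\subset N_{i+1}$ and all prime factors of $s_i$ are $\ge t_i$; the minimal such $s_i$ is called the characteristic of $N_i$ in $N_{i+1}$. *)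

(* Defs.v *)
From HB Require Import structures.
From mathcomp Require Import all_boot all_order all_algebra.
From mathcomp Require Import generic_quotient ring_quotient finmap.
From mathcomp Require Import boolp classical_sets cardinality.

Set Implicit Arguments.
Unset Strict Implicit.
Unset Printing Implicit Defensive.

Import GRing.Theory.
Local Open Scope classical_set_scope.
Local Open Scope quotient_scope.
Local Open Scope ring_scope.

(* Rings are [pzRingType]s: unital, associative, not necessarily commutative,
   the zero ring allowed (so R/I is a ring even when I = R). *)

Definition units (S : pzRingType) : set S :=
  [set x | exists y, x * y = 1 /\ y * x = 1].
Arguments units : clear implicits.

(* Two-sided, not necessarily proper. *)
Record ideal (R : pzRingType) := Ideal {
  ideal_set :> set R;
  ideal_zero : ideal_set 0;
  ideal_sub : forall x y, ideal_set x -> ideal_set y -> ideal_set (x - y);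
  ideal_mull : forall a x, ideal_set x -> ideal_set (a * x);
  ideal_mulr : forall x a, ideal_set x -> ideal_set (x * a) }.

(* ring_quotient.v provides the ring R/I only for commutative R; below, its
   additive quotient is equipped with the induced multiplication. *)
Section QuotientRing.
Variables (R : pzRingType) (I : ideal R).

Definition ideal_pred : {pred R} := fun x => x \in (I : set R).

Lemma ideal_predP x : reflect (ideal_set I x) (x \in ideal_pred).
Proof. by apply: (iffP idP); rewrite unfold_in /ideal_pred inE. Qed.

Fact ideal_zmod_closed : zmod_closed ideal_pred.
Proof.
split; first exact/ideal_predP/ideal_zero.
by move=> x y /ideal_predP Ix /ideal_predP Iy; exact/ideal_predP/ideal_sub.
Qed.

HB.instance Definition _ :=
  GRing.isZmodClosed.Build R ideal_pred ideal_zmod_closed.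

Definition quot_ring := Quotient.quot ideal_pred.

HB.instance Definition _ := GRing.Zmodule.on quot_ring.

Definition quot_one : quot_ring := \pi_(Quotient.quot ideal_pred) 1.
Definition quot_mul (x y : quot_ring) : quot_ring :=
  \pi_(Quotient.quot ideal_pred)
    (repr (x : Quotient.quot ideal_pred) * repr (y : Quotient.quot ideal_pred)).

Definition quot_pi (x : R) : quot_ring := \pi_(Quotient.quot ideal_pred) x.
Local Notation pi := quot_pi.

Lemma quot_pi_eqP x y : reflect (pi x = pi y) (x - y \in ideal_pred).
Proof. by rewrite (Quotient.idealrBE ideal_pred); exact: eqP. Qed.

Let quotW (P : quot_ring -> Prop) : (forall x, P (pi x)) -> forall x, P x.
Proof.
move=> Ppi x; have := Ppi (repr (x : Quotient.quot ideal_pred)).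
by rewrite /quot_pi reprK.
Qed.

Let repr_pi x :
  repr (pi x : Quotient.quot ideal_pred) - x \in ideal_pred.
Proof. by apply/quot_pi_eqP; rewrite /quot_pi reprK. Qed.

Lemma quot_pi_add x y : pi (x + y) = pi x + pi y.
Proof. exact: Quotient.pi_add. Qed.

Lemma quot_pi_mul x y : pi (x * y) = quot_mul (pi x) (pi y).
Proof.
apply/esym/quot_pi_eqP; set x' := repr _; set y' := repr _.
have -> : x' * y' - x * y = (x' - x) * y' + x * (y' - y).
  by rewrite mulrBl mulrBr addrA subrK.
apply: rpredD; apply/ideal_predP.
  by apply: ideal_mulr; exact/ideal_predP/repr_pi.
by apply: ideal_mull; exact/ideal_predP/repr_pi.
Qed.

Fact quot_mulA : associative quot_mul.
Proof.
by elim/quotW=> x; elim/quotW=> y; elim/quotW=> z; rewrite -!quot_pi_mul mulrA.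
Qed.

Fact quot_mul1x : left_id quot_one quot_mul.
Proof. by elim/quotW=> x; rewrite -quot_pi_mul mul1r. Qed.

Fact quot_mulx1 : right_id quot_one quot_mul.
Proof. by elim/quotW=> x; rewrite -quot_pi_mul mulr1. Qed.

Fact quot_mulDl : left_distributive quot_mul +%R.
Proof.
elim/quotW=> x; elim/quotW=> y; elim/quotW=> z.
by rewrite -quot_pi_add -!quot_pi_mul mulrDl quot_pi_add.
Qed.

Fact quot_mulDr : right_distributive quot_mul +%R.
Proof.
elim/quotW=> x; elim/quotW=> y; elim/quotW=> z.
by rewrite -quot_pi_add -!quot_pi_mul mulrDr quot_pi_add.
Qed.

HB.instance Definition _ := GRing.Zmodule_isPzRing.Build quot_ring
  quot_mulA quot_mul1x quot_mulx1 quot_mulDl quot_mulDr.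

End QuotientRing.

Section ProductRing.
Variables (T : finType) (R : T -> pzRingType).

Definition prod_ring := {dffun forall i : T, R i}.

HB.instance Definition _ := Choice.on prod_ring.

Implicit Types x y : prod_ring.

Definition prod_zero : prod_ring := [ffun i => 0 : R i].
Definition prod_opp x : prod_ring := [ffun i => - x i].
Definition prod_add x y : prod_ring := [ffun i => x i + y i].
Definition prod_one : prod_ring := [ffun i => 1 : R i].
Definition prod_mul x y : prod_ring := [ffun i => x i * y i].

Fact prod_addA : associative prod_add.
Proof. by move=> x y z; apply/ffunP=> i; rewrite !ffunE addrA. Qed.
Fact prod_addC : commutative prod_add.
Proof. by move=> x y; apply/ffunP=> i; rewrite !ffunE addrC. Qed.
Fact prod_add0x : left_id prod_zero prod_add.
Proof. by move=> x; apply/ffunP=> i; rewrite !ffunE add0r. Qed.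
Fact prod_addNx : left_inverse prod_zero prod_opp prod_add.
Proof. by move=> x; apply/ffunP=> i; rewrite !ffunE addNr. Qed.

HB.instance Definition _ := GRing.isZmodule.Build prod_ring
  prod_addA prod_addC prod_add0x prod_addNx.

Fact prod_mulA : associative prod_mul.
Proof. by move=> x y z; apply/ffunP=> i; rewrite !ffunE mulrA. Qed.
Fact prod_mul1x : left_id prod_one prod_mul.
Proof. by move=> x; apply/ffunP=> i; rewrite !ffunE mul1r. Qed.
Fact prod_mulx1 : right_id prod_one prod_mul.
Proof. by move=> x; apply/ffunP=> i; rewrite !ffunE mulr1. Qed.
Fact prod_mulDl : left_distributive prod_mul +%R.
Proof. by move=> x y z; apply/ffunP=> i; rewrite !ffunE mulrDl. Qed.
Fact prod_mulDr : right_distributive prod_mul +%R.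
Proof. by move=> x y z; apply/ffunP=> i; rewrite !ffunE mulrDr. Qed.

HB.instance Definition _ := GRing.Zmodule_isPzRing.Build prod_ring
  prod_mulA prod_mul1x prod_mulx1 prod_mulDl prod_mulDr.

End ProductRing.

Section CNC.
Variable R : pzRingType.
Implicit Types I J : set R.

Definition ideal_mul I J : set R :=
  [set x | exists r : seq (R * R),
     (forall p, p \in r -> I p.1 /\ J p.2) /\ x = \sum_(p <- r) p.1 * p.2].

(* I^0 = R, I^(t+1) = I^t I. *)
Definition ideal_exp I (t : nat) : set R :=
  iter t (fun J => ideal_mul J I) setT.

Definition is_least (P : set nat) (n : nat) : Prop :=
  P n /\ forall m, P m -> (n <= m)%N.

Definition nil_exponents I J : set nat :=
  [set t | (2 <= t)%N /\ ideal_exp I t `<=` J].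

Definition nilpotency_index I J (t : nat) : Prop :=
  is_least (nil_exponents I J) t.

Definition char_multiples I J (t : nat) : set nat :=
  [set s | [/\ (1 <= s)%N, (forall x, I x -> J (x *+ s))
             & forall p, prime p -> (p %| s)%N -> (t <= p)%N]].

Definition characteristic I J (s : nat) : Prop :=
  exists t, nilpotency_index I J t /\ is_least (char_multiples I J t) s.

(* The collection is N 1, ..., N k; the other values of N are irrelevant. *)
Definition CNC (k : nat) (N : nat -> ideal R) : Prop :=
  [/\ (1 <= k)%N,
      (N k : set R) = [set 0],
      forall l, (1 <= l < k)%N -> N l.+1 `<=` N l
    & forall l, (1 <= l < k)%N ->
        exists t, nil_exponents (N l) (N l.+1) t /\
        exists s, char_multiples (N l) (N l.+1) t s].

End CNC.

(* Main.v *)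
Require Import Defs.
From mathcomp Require Import all_boot all_order all_algebra.
From mathcomp Require Import fingroup perm action.
From mathcomp Require Import finmap boolp classical_sets cardinality.

Import GRing.Theory.
Local Open Scope ring_scope.

(** By Lagrange's theorem, raising a unit of [R] to the power |(R/N_1)^*| gives
    an element of [1 + N_1].  If [x] lies in [N_l], then [(1 + x)^s_l] lies in
    [1 + N_(l+1)]: in its binomial expansion the terms of degree at least [t_l]
    lie in [N_l^t_l], and for [0 < i < t_l] the index [i] is coprime to [s_l],
    so that [s_l] divides [i * 'C(s_l, i) = s_l * 'C(s_l - 1, i - 1)] and hence
    ['C(s_l, i)]. Going down the chain of ideals ends in [1 + N_k = {1}]. *)

(** All point stabilisers in the cyclic group [<[p]>] are trivial, so every orbit has [#[p]]
    elements, and the orbits partition [T]. This replaces the coset count in Lagrange's theorem. *)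
Lemma semiregular_perm_order_dvdn (T : finType) (p : {perm T}) :
  (forall (x : T) (n : nat), (p ^+ n)%g x = x -> (p ^+ n)%g = 1%g) ->
  (#[p]%g %| #|T|)%N.
Proof.
move=> semireg.
have actsT : [acts <[p]>%g, on [set: T] | 'P%act].
  by apply/actsP=> a _ x; rewrite !inE.
rewrite -cardsT (card_uniform_partition (n := #[p]%g) _ (orbit_partition actsT)).
  exact: dvdn_mull.
move=> _ /imsetP[x _ ->]; rewrite card_orbit.
suff -> : ('C_(<[p]>)[x | 'P])%g = 1%g by rewrite indexg1.
apply/trivgP/fintype.subsetP=> a /finset.setIP[/cycleP[n ->]] /astab1P pnx.
by apply/set1P/(semireg x).
Qed.

Section Units.
Variable S : pzRingType.

Lemma units1 : units S 1.
Proof. by exists 1; rewrite !mulr1. Qed.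

Lemma unitsM {u v : S} : units S u -> units S v -> units S (u * v).
Proof.
move=> [u' [uu' u'u]] [v' [vv' v'v]]; exists (v' * u'); split.
  by rewrite mulrA -(mulrA u) vv' mulr1.
by rewrite mulrA -(mulrA v') u'u mulr1.
Qed.

Lemma mulrI_units {u : S} : units S u -> injective ( *%R u).
Proof.
by move=> [v [_ vu]] x y /(congr1 ( *%R v)); rewrite !mulrA vu !mul1r.
Qed.

Lemma mulIr_units {u : S} : units S u -> injective ( *%R^~ u).
Proof.
by move=> [v [uv _]] x y /(congr1 ( *%R^~ v)); rewrite -!mulrA uv !mulr1.
Qed.

(** Left multiplication by [u] permutes the finite set of units. A power of it that fixes some unit
    [x] satisfies [u ^+ n * x = x]; cancelling [x] makes that power the identity, so the previous
    divisibility applies. *)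
Lemma expr_card_units (u : S) : finite_set (units S) -> units S u ->
  u ^+ #|` fset_set (units S)| = 1.
Proof.
move=> finU Uu; set A := fset_set (units S).
(* [fset_set] is empty on infinite sets, so this needs [finU]. *)
have inA x : (x \in A) <-> units S x.
  by rewrite in_fset_set //; split=> [/set_mem|/mem_set].
have mulA (x : A) : u * val x \in A.
  by apply/inA/(unitsM Uu)/inA/(valP x).
have inj_mul : injective (fun x : A => [` mulA x]%fset).
  by move=> x y /(congr1 val) /(mulrI_units Uu) /val_inj.
pose p := perm inj_mul.
have pE n (x : A) : val ((p ^+ n)%g x) = u ^+ n * val x.
  elim: n x => [|n IHn] x; first by rewrite expg0 perm1 mul1r.
  by rewrite expgSr permM permE /= IHn exprS mulrA.
have A1 : 1 \in A by apply/inA/units1.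
have /dvdnP[q cardA] : (#[p]%g %| #|{: A}|)%N.
  apply: semiregular_perm_order_dvdn => x n /(congr1 val).
  rewrite pE -[RHS]mul1r => /(mulIr_units ((inA _).1 (valP x))) un1.
  by apply/permP=> z; apply: val_inj; rewrite pE un1 mul1r perm1.
(* Evaluating the trivial power of [p] at the unit 1 recovers the power of [u] itself. *)
have := pE #|{: A}| [` A1]%fset.
by rewrite cardA mulnC expgM expg_order expg1n perm1 /= mulr1 mulnC -cardA cardfE.
Qed.

End Units.

Section Ideals.
Variable R : pzRingType.

Lemma idealD (I : ideal R) x y : ideal_set I x -> ideal_set I y -> ideal_set I (x + y).
Proof.
move=> Ix Iy; rewrite -[y]opprK -[- y]sub0r.
by apply: ideal_sub => //; apply: ideal_sub => //; apply: ideal_zero.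
Qed.

Lemma ideal_sum (I : ideal R) (A : Type) (r : seq A) (P : pred A) (F : A -> R) :
  (forall a, P a -> ideal_set I (F a)) -> ideal_set I (\sum_(a <- r | P a) F a).
Proof. by move=> IF; apply: big_ind => //; [apply: ideal_zero | apply: idealD]. Qed.

Lemma idealMn (I : ideal R) x n : ideal_set I x -> ideal_set I (x *+ n).
Proof. by move=> Ix; rewrite -mulr_natl; apply: ideal_mull. Qed.

Lemma expr_ideal_exp (I : set R) x t : I x -> ideal_exp I t (x ^+ t).
Proof.
move=> Ix; elim: t => [//|t IHt].
exists [:: (x ^+ t, x)]; split; last by rewrite big_seq1 exprSr.
by move=> p; rewrite inE => /eqP ->.
Qed.

Lemma quot_piX (I : ideal R) x n : quot_pi I (x ^+ n) = quot_pi I x ^+ n.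
Proof. by elim: n => [//|n IHn]; rewrite !exprS quot_pi_mul IHn. Qed.

Lemma units_quot_pi (I : ideal R) u :
  units R u -> units (quot_ring I) (quot_pi I u).
Proof.
by move=> [v [uv vu]]; exists (quot_pi I v); split;
  [move/(congr1 (quot_pi I)): uv | move/(congr1 (quot_pi I)): vu];
  rewrite quot_pi_mul.
Qed.

End Ideals.

Lemma dvdn_bin_coprime s i : (0 < i)%N -> coprime s i -> (s %| 'C(s, i))%N.
Proof.
case: i => // i _ co; case: s co => [|s] co.
  (* For [s = 0], coprimality forces the lower index to be 1, and ['C(0, 1) = 0]. *)
  by move: co; rewrite /coprime gcd0n => /eqP [->]; rewrite bin0n.
by rewrite -(Gauss_dvdr _ co) -mul_bin_diag dvdn_mulr.
Qed.

Section OneStep.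
Variables (R : pzRingType) (I J : ideal R) (s t : nat).
Hypothesis tP : nil_exponents I J t.
Hypothesis sP : char_multiples I J t s.

Lemma expr_sub1_ideal z : ideal_set I (z - 1) -> ideal_set J (z ^+ s - 1).
Proof.
have [_ expIJ] := tP; have [s_gt0 mulIJ sprime] := sP.
set x := z - 1 => Ix; have -> : z = x + 1 by rewrite subrK.
rewrite exprDn_comm; last exact: commr1.
under eq_bigr do rewrite expr1n mulr1.
(* The summation index is the exponent of 1, so the last term is the constant one and cancels
   against [- 1]. *)
rewrite big_ord_recr /= binn subnn expr0 mulr1n addrK.
apply: ideal_sum => -[i lt_is] _ /=.
have d_gt0 : (0 < s - i)%N by rewrite subn_gt0.
(* By symmetry of the binomial coefficients, everything is expressed in the degree [d] of the term
   in [x]. *)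
rewrite -bin_sub 1?ltnW //; set d := (s - i)%N in d_gt0 *.
have [le_td|lt_dt] := leqP t d.
  apply: idealMn; rewrite -(subnKC le_td) exprD.
  exact/ideal_mulr/expIJ/expr_ideal_exp.
have /dvdnP[c ->] : (s %| 'C(s, d))%N.
  (* A common prime factor [p] of [s] and [d] would give [p <= d < t <= p]. *)
  apply: dvdn_bin_coprime => //; rewrite coprime_sym coprime_has_primes //.
  apply/hasPn=> p; rewrite !mem_primes => /and3P[p_pr _ p_s].
  apply/negP=> /and3P[_ _ /(dvdn_leq d_gt0)].
  by rewrite leqNgt (leq_trans lt_dt) // sprime.
rewrite mulnC mulrnA; apply/idealMn/mulIJ.
by case: d d_gt0 {lt_dt c} => // d _; rewrite exprS; apply: ideal_mulr.
Qed.

End OneStep.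

Lemma CNC_expr_units (R : pzRingType) (k : nat) (N : nat -> ideal R)
    (s : nat -> nat) (u : R) :
  CNC k N ->
  (forall l, (1 <= l < k)%N -> characteristic (N l) (N l.+1) (s l)) ->
  finite_set (units (quot_ring (N 1%N))) -> units R u ->
  u ^+ (#|` fset_set (units (quot_ring (N 1%N)))|
         * \prod_(1 <= l < k) s l)%N = 1.
Proof.
move=> [k_gt0 Nk0 _ _] hs finU Uu; set c := #|` _|.
(* The shift by one starts the induction at [N 1] with an empty product, where it is Lagrange in the
   quotient; [l = k.-1] reaches [N k], the zero ideal. *)
suff chain l : (l < k)%N ->
    ideal_set (N l.+1) (u ^+ (c * \prod_(1 <= i < l.+1) s i)%N - 1).
  have := chain k.-1; rewrite prednK // Nk0 => /(_ (leqnn k)) /eqP.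
  by rewrite subr_eq0 => /eqP.
elim: l => [_|l IHl lt_lk].
  rewrite big_geq // muln1; apply/ideal_predP/quot_pi_eqP.
  by rewrite quot_piX expr_card_units //; apply: units_quot_pi.
have [t [[tP _] [sP _]]] := hs l.+1 lt_lk.
rewrite big_nat_recr //= mulnA exprM.
by apply: (expr_sub1_ideal _ _ _ _ _ tP sP); apply/IHl/ltnW.
Qed.

Lemma prod_ringX (T : finType) (R : T -> pzRingType) (y : prod_ring R) n i :
  (y ^+ n) i = y i ^+ n.
Proof. by elim: n => [|n IHn]; rewrite ?exprS ffunE ?IHn. Qed.

Theorem theorem3p3 (j : nat) (R : 'I_j -> pzRingType) (k : 'I_j -> nat)
    (N : forall i : 'I_j, nat -> ideal (R i)) (s : 'I_j -> nat -> nat)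
    (hN : forall i : 'I_j, CNC (k i) (N i))
    (hs : forall (i : 'I_j) (l : nat), (1 <= l < k i)%N ->
       characteristic (N i l) (N i l.+1) (s i l))
    (hfin : forall i : 'I_j, finite_set (units (quot_ring (N i 1%N)))) :
  let m := fun i : 'I_j =>
    (#|` fset_set (units (quot_ring (N i 1%N)))|
      * \prod_(1 <= l < k i) s i l)%N in
  let M := \big[lcmn/1%N]_(i < j) m i in
  forall y : prod_ring R, (forall i : 'I_j, units (R i) (y i)) ->
    y ^+ M = [ffun i => 1 : R i].
Proof.
move=> m M y Uy; apply/ffunP=> i; rewrite prod_ringX ffunE.
(* Powers are componentwise, so it is enough that [M] is a multiple of each exponent [m i]. *)
have /dvdnP[q ->] : (m i %| M)%N by rewrite /M (bigD1 i) //= dvdn_lcml.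
by rewrite mulnC exprM (CNC_expr_units _ _ _ _ _ (hN i) (hs i)) // expr1n.
Qed.
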